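(* Suppose that $A$ and $B$ are Aronszajn lines with respective decompositions $D$ and $E$. If $B \trianglelefteq A$ (that is, there is an epimorphism from $A$ onto $B$), then $\hat{\mathscr{L}}(A,D)\setminus \hat{\mathscr{L}}(B,E)$ and $\hat{\mathscr{R}}(A,D)\setminus\hat{\mathscr{R}}(B,E)$ are non-stationary subsets of $\omega_1$.
   Context: An epimorphism from a linear order $A$ onto a linear order $B$ is a surjective monotone map $f:A\to B$ ($x\le y$ implies $f(x)\le f(y)$). Write $B\trianglelefteq A$ if $B=\varnothing$ or there is an epimorphism from $A$ onto $B$. An Aronszajn line is an uncountable linear order containing no copy of $\omega_1$, of its reverse $\omega_1^{\star}$, or of any uncountable set of reals. (Every Aronszajn line has size $\aleph_1$.) A decomposition for an Aronszajn line $A$ is a $\subseteq$-increasing sequence $D=\langle D_\xi:\xi<\omega_1\rangle$ of countable subsets of $A$ which covers $A$ and is continuous ($D_\xi=\bigcup_{\eta<\xi}D_\eta$ for limit $\xi$). An interval of $A$ is a nonempty convex subset. The complementary intervals of $A\setminus D_\xi$ are the intervals of $A$ that are maximal with respect to not having points in $D_\xi$. An interval has a left (right) endpoint if it has a minimum (maximum). $\hat{\mathscr{L}}(A,D)$ (resp. $\hat{\mathscr{R}}(A,D)$) is the set of $\xi<\omega_1$ such that every complementary interval of $A\setminus D_\xi$ has a left (resp. right) endpoint. *)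

(* Defs.v *)
From HB Require Import structures.
From mathcomp Require Import all_boot all_order.
From mathcomp Require Import boolp classical_sets cardinality wochoice reals.

Set Implicit Arguments.
Unset Strict Implicit.
Unset Printing Implicit Defensive.

Local Open Scope order_scope.
Local Open Scope classical_set_scope.

(* The ordinal omega_1 is any linear order W of this order type: an uncountable
   well-order all of whose proper initial segments are countable. Such a W is
   unique up to isomorphism. *)
Definition is_omega1 (dW : Order.disp_t) (W : orderType dW) : Prop :=
  [/\ well_order (<=%O : rel W), ~ countable [set: W]
    & forall xi : W, countable [set eta : W | eta < xi]].

Section Omega1.
Context {dW : Order.disp_t} {W : orderType dW}.
Implicit Types (xi eta zeta : W) (C S : set W).

(* The least element is not a limit. *)
Definition is_limit xi : Prop :=
  (exists eta, eta < xi) /\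
  forall eta, eta < xi -> exists2 zeta, eta < zeta & zeta < xi.

Definition unbounded C : Prop := forall eta, exists2 zeta, C zeta & eta < zeta.

Definition closed_in_order C : Prop :=
  forall xi, is_limit xi ->
    (forall eta, eta < xi -> exists2 zeta, C zeta & eta < zeta < xi) -> C xi.

Definition club C : Prop := unbounded C /\ closed_in_order C.

Definition stationary S : Prop := forall C, club C -> S `&` C !=set0.

End Omega1.

Section LinearOrders.
Context {dA : Order.disp_t} {A : orderType dA}.
Implicit Types I J X : set A.

Definition order_interval I : Prop :=
  I !=set0 /\ forall x y z, I x -> I z -> x <= y <= z -> I y.

Definition has_left_endpoint I : Prop := exists2 x, I x & lbound I x.

Definition has_right_endpoint I : Prop := exists2 x, I x & ubound I x.

Definition complementary_interval X I : Prop :=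
  [/\ order_interval I, I `&` X = set0
    & forall J, order_interval J -> J `&` X = set0 -> I `<=` J -> J = I].

End LinearOrders.

Definition epi_le (dB dA : Order.disp_t) (B : orderType dB) (A : orderType dA)
    : Prop :=
  [set: B] = set0 \/
  exists f : A -> B, {homo f : x y / x <= y} /\ range f = setT.

Definition aronszajn_line (dW : Order.disp_t) (W : orderType dW)
    (R : realType) (dA : Order.disp_t) (A : orderType dA) : Prop :=
  [/\ ~ countable [set: A],
      ~ (exists f : W -> A, {mono f : x y / x <= y}),
      ~ (exists f : W -> A, {mono f : x y /~ x <= y})
    & ~ (exists (X : set R) (f : R -> A),
           ~ countable X /\ {in X &, {mono f : x y / x <= y}})].

Section Decompositions.
Context {dW : Order.disp_t} {W : orderType dW}.
Context {dA : Order.disp_t} {A : orderType dA}.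
Implicit Types D : W -> set A.

Definition decomposition D : Prop :=
  [/\ forall xi, countable (D xi),
      forall eta xi, eta <= xi -> D eta `<=` D xi,
      \bigcup_xi D xi = setT
    & forall xi, is_limit xi ->
        D xi = \bigcup_(eta in [set eta | eta < xi]) D eta].

Definition Lhat D : set W :=
  [set xi | forall I, complementary_interval (D xi) I -> has_left_endpoint I].

Definition Rhat D : set W :=
  [set xi | forall I, complementary_interval (D xi) I -> has_right_endpoint I].

End Decompositions.

(* Main.v *)
Require Import Defs.
From mathcomp Require Import all_boot all_order.
From mathcomp Require Import classical_sets reals.
From mathcomp Require Import boolp cardinality wochoice.

(** Let f be an epimorphism from A onto B.  Call xi good when f maps D_xi into
    E_xi and, for every b in E_xi, the set D_xi is both cofinal and coinitial
    in the fibre of f over b.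

    At a good xi, the complementary intervals of E_xi pull back to
    complementary intervals of D_xi.  Indeed, suppose that x and i lie on the
    same side of every point of D_xi, that f i is not in E_xi, and that some e
    in E_xi satisfies f x <= e < f i.  Either f x < e, and any point of D_xi
    over e lies between x and i, or x itself is in the fibre over e, and
    cofinality gives a point d >= x of D_xi in this fibre; again x <= d < i,
    which is impossible.  The reversed inequalities are handled by
    coinitiality.  Conversely, points of D_xi between x and i are sent to
    points of E_xi that separate f x from f i.  So the preimage of a
    complementary interval J of E_xi is one of D_xi
    ([preimage_component], [complementary_lift]); if it has a minimum a, then
    f a is the minimum of J, and likewise for maxima.  Hence no good xi
    belongs to either of the two differences.

    It remains to see that the good xi contain a club
    ([club_fibres_witnessed]).  Since A contains no copy of omega_1 or of its
    reverse, every subset of A has a countable cofinal subset and a countable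
    coinitial one ([countable_cofinal], [countable_coinitial]): otherwise a
    recursion along omega_1 would produce such a copy.  Applied to the
    countably many fibres over E_eta, this gives countably many points of A,
    all of which lie in a single D_zeta.  Every limit closed under this passage
    from eta to zeta is good by continuity of the decompositions, and such
    closure points form a club ([club_closure_points]). *)

Set Implicit Arguments.
Unset Strict Implicit.
Unset Printing Implicit Defensive.

Import Order.TTheory.

Local Open Scope order_scope.
Local Open Scope classical_set_scope.

(** * Clubs of omega_1 and countable cofinality *)

Section Omega1.
Context {dW : Order.disp_t} {W : orderType dW} (hW : is_omega1 W).
Implicit Types (xi eta zeta : W) (S : set W).

Lemma omega1_min S : S !=set0 -> exists2 m, S m & lbound S m.
Proof.
move=> [x Sx]; have [wo _ _] := hW.
have [|m [[Sm lbm] _]] := wo [pred x | `[< S x >]].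
  by exists x; apply/asboolP.
exists m; first exact/asboolP.
by move=> y Sy; apply: lbm; apply/asboolP.
Qed.

Lemma omega1_wf : well_founded (fun eta xi => eta < xi).
Proof.
move=> x; apply: contrapT => nax.
have [|m nam lbm] := @omega1_min [set x | ~ Acc (fun eta xi => eta < xi) x].
  by exists x.
apply: nam; constructor => y ym; apply: contrapT => /lbm.
by rewrite leNgt ym.
Qed.

(** Otherwise omega_1 would be the union of S and of countably many proper
    initial segments, all of them countable. *)
Lemma omega1_ub S : countable S -> exists zeta, forall eta, S eta -> eta < zeta.
Proof.
move=> cS; have [_ unc init] := hW; apply: contrapT => nub; apply: unc.
have -> : [set: W] = \bigcup_(eta in S) [set xi | xi < eta] `|` S.
  rewrite eqEsubset; split => // xi _.
  apply: contrapT => nxi; apply: nub; exists xi => eta Seta.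
  rewrite ltNge le_eqVlt; apply/negP => /orP[/eqP xe|lt]; apply: nxi.
    by right; rewrite xe.
  by left; exists eta.
rewrite -bigcup2E; apply: bigcup_countable => // -[|[|n]] _ //=.
by apply: bigcup_countable => // eta _; apply: init.
Qed.

(** Iterate eta |-> zeta omega times from any starting point: the least upper
    bound of the resulting strictly increasing sequence is closed under P, by
    antitonicity of P in its first argument. *)
Lemma club_closure_points (P : W -> W -> Prop) :
  (forall eta eta' zeta, eta' <= eta -> P eta zeta -> P eta' zeta) ->
  (forall eta, exists2 zeta, P eta zeta & eta < zeta) ->
  club [set xi | is_limit xi /\
          forall eta, eta < xi -> exists2 zeta, P eta zeta & zeta < xi].
Proof.
move=> Panti Pex; split; last first.
  move=> xi lim cof; split=> // eta /cof[zeta [_ Cz] /andP[ez zx]].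
  have [z Pz zz] := Cz _ ez.
  by exists z => //; apply: lt_trans zx.
have /boolp.choice[h hP] eta : exists zeta, P eta zeta /\ eta < zeta.
  by have [zeta ? ?] := Pex eta; exists zeta.
move=> eta0; pose u n := iter n h eta0.
have uS n : u n < u n.+1 by have [] := hP (u n).
have [|xi ubxi lbxi] := @omega1_min [set xi | forall n, u n <= xi].
  have [|zeta ub] := @omega1_ub (range u).
    exact: card_image_le.
  by exists zeta => n; apply/ltW/ub; exists n.
have ult n : u n < xi by apply: lt_le_trans (ubxi n.+1).
have between eta : eta < xi -> exists n, eta < u n.
  move=> lt; apply: contrapT => nn; move: lt; rewrite ltNge.
  move=> /negP; apply; apply: lbxi => n.
  by rewrite leNgt; apply/negP => lt; apply: nn; exists n.
exists xi; last exact: (ult 0%N).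
split; first split; first by exists eta0; exact: (ult 0%N).
  by move=> eta /between[n lt]; exists (u n).
move=> eta /between[n lt]; exists (u n.+1) => //.
by apply: Panti (ltW lt) _; have [] := hP (u n).
Qed.

Section Cofinality.
Context {dA : Order.disp_t} {A : orderType dA}.
Implicit Types X Y : set A.

(** Every value of the embedding is chosen above the countably many values
    taken before it. *)
Lemma omega1_embedding X :
  (forall Y, countable Y -> Y `<=` X ->
     exists2 x, X x & forall y, Y y -> y < x) ->
  exists f : W -> A, {mono f : x y / x <= y}.
Proof.
move=> up.
(* A default value, for the sets Y to which the hypothesis says nothing. *)
have [a0 _ _] := up set0 (countable0 _) (fun _ => False_ind _).
have /boolp.choice[s sP] Y : exists x, countable Y -> Y `<=` X ->
    X x /\ forall y, Y y -> y < x.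
  have [[cY YX]|nY] := pselect (countable Y /\ Y `<=` X).
    by have [x Xx xP] := up _ cY YX; exists x.
  by exists a0 => cY YX; case: nY.
pose F xi (rec : forall eta, eta < xi -> A) :=
  s [set a | exists eta (h : eta < xi), rec eta h = a].
pose g := Fix omega1_wf (fun=> A) F.
have gE xi : g xi = s (g @` [set eta | eta < xi]).
  rewrite /g Fix_eq; last first.
    move=> x r r' rr'; rewrite /F; congr s; apply/seteqP; split => a /=;
    by move=> [eta [h <-]]; exists eta, h; rewrite rr'.
  rewrite /F; congr s; apply/seteqP; split => a /=.
    by move=> [eta [h <-]]; exists eta.
  by move=> [eta h <-]; exists eta, h.
have cI xi : countable (g @` [set eta | eta < xi]).
  apply: sub_countable (card_image_le _ _) _.
  by have [_ _] := hW; apply.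
have gX xi : X (g xi).
  elim/(well_founded_ind omega1_wf): xi => xi IH.
  rewrite gE; apply: (sP _ (cI xi) _).1.
  by move=> _ [eta /IH ? <-].
exists g; apply: le_mono => eta xi lt.
rewrite [ltRHS]gE; apply: (sP _ (cI xi) _).2; last by exists eta.
by move=> _ [? _ <-].
Qed.

Lemma countable_cofinal X :
  ~ (exists f : W -> A, {mono f : x y / x <= y}) ->
  exists Y, [/\ countable Y, Y `<=` X &
    forall x, X x -> exists2 y, Y y & x <= y].
Proof.
move=> nemb; apply: contrapT => ncof; apply: nemb.
apply: (@omega1_embedding X) => Y cY YX; apply: contrapT => nub.
apply: ncof; exists Y; split=> // x Xx; apply: contrapT => nle.
apply: nub; exists x => // y Yy; rewrite ltNge; apply/negP => xy.
by apply: nle; exists y.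
Qed.

End Cofinality.

Lemma countable_coinitial {dA : Order.disp_t} {A : orderType dA} (X : set A) :
  ~ (exists f : W -> A, {mono f : x y /~ x <= y}) ->
  exists Y, [/\ countable Y, Y `<=` X &
    forall x, X x -> exists2 y, Y y & y <= x].
Proof.
move=> nemb; apply: (@countable_cofinal _ (A^d)%type X).
by move=> [f fm]; apply: nemb; exists f => x y; have := fm y x.
Qed.

(** The indices at which the points of X appear form a countable, hence
    bounded, subset of omega_1. *)
Lemma decomposition_absorbs {dA : Order.disp_t} {A : orderType dA}
    (D : W -> set A) (X : set A) :
  decomposition D -> countable X -> exists xi, X `<=` D xi.
Proof.
move=> [_ Dmono Dcov _] cX.
have /boolp.choice[r rP] a : exists xi, D xi a.
  by have : setT a by []; rewrite -Dcov => -[xi _]; exists xi.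
have [|xi ub] := @omega1_ub (r @` X).
  exact: sub_countable (card_image_le _ _) cX.
by exists xi => a Xa; apply: Dmono (rP a); apply/ltW/ub; exists a.
Qed.

End Omega1.

(** * Complementary intervals as components *)

Section Components.
Context {dA : Order.disp_t} {A : orderType dA}.
Implicit Types X I J : set A.

(** For i outside X this is the complementary interval around i.  Asking that
    both strict comparisons with the points of X agree keeps the definition
    invariant under reversal of the order, and excludes the points of X. *)
Definition component X i : set A :=
  [set x | forall d, X d -> (d < x) = (d < i) /\ (x < d) = (i < d)].

Lemma component_disjoint X i : ~ X i -> component X i `&` X = set0.
Proof.
move=> nXi; apply/seteqP; split=> // x [cx Xx] /=.
have [] := cx x Xx; rewrite ltxx => /esym ltxi /esym ltix.
by case: (ltgtP x i) ltxi ltix => // xi; move: nXi; rewrite -xi.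
Qed.

Lemma component_interval X i : order_interval (component X i).
Proof.
split; first by exists i.
move=> x y z cx cz /andP[xy yz] d Xd.
have [x1 x2] := cx d Xd; have [z1 z2] := cz d Xd; split.
  apply/idP/idP => lt; first by rewrite -z1 (lt_le_trans lt).
  by rewrite -x1 in lt; apply: lt_le_trans xy.
apply/idP/idP => lt; first by rewrite -x2 (le_lt_trans xy).
by rewrite -z2 in lt; apply: le_lt_trans lt.
Qed.

Lemma interval_sub_component X I i :
  order_interval I -> I `&` X = set0 -> I i -> I `<=` component X i.
Proof.
move=> [_ conv] dis Ii x Ix d Xd.
have nId : ~ I d by move=> Id; have : set0 d by rewrite -dis.
(* A point d of X between two points of I would itself be in I. *)
have key u v : I u -> I v -> d < u -> d < v.
  move=> Iu Iv du; rewrite ltNge; apply/negP => vd; apply: nId.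
  by apply: (conv v d u) => //; rewrite vd ltW.
have key' u v : I u -> I v -> u < d -> v < d.
  move=> Iu Iv du; rewrite ltNge; apply/negP => vd; apply: nId.
  by apply: (conv u d v) => //; rewrite vd ltW.
by split; apply/idP/idP; [apply: key|apply: key|apply: key'|apply: key'].
Qed.

Lemma component_complementary X i :
  ~ X i -> complementary_interval X (component X i).
Proof.
move=> nXi; split; [exact: component_interval|exact: component_disjoint|].
move=> J Jint Jdis cJ; apply/seteqP; split=> //.
by apply: interval_sub_component => //; apply: cJ.
Qed.

Lemma complementary_is_component X I i :
  complementary_interval X I -> I i -> I = component X i.
Proof.
move=> [Iint Idis Imax] Ii; apply/esym/Imax.
- exact: component_interval.
- by apply: component_disjoint => Xi; have : set0 i by rewrite -Idis.
- exact: interval_sub_component.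
Qed.

End Components.

(** * Pushing endpoints forward along an epimorphism *)

Section Transfer.
Context {dA dB : Order.disp_t} {A : orderType dA} {B : orderType dB}.
Variables (f : A -> B) (fmono : {homo f : x y / x <= y}).
Hypothesis fsurj : range f = setT.

(** Cofinality and coinitiality of X in the fibres of f over Y, with a
    ranging over all points of the fibre over f a. *)
Definition fibres_witnessed (X : set A) (Y : set B) : Prop :=
  forall a, Y (f a) ->
    (exists d, [/\ X d, f d = f a & a <= d]) /\
    (exists d, [/\ X d, f d = f a & d <= a]).

Variables (X : set A) (Y : set B).
Hypotheses (fXY : f @` X `<=` Y) (wit : fibres_witnessed X Y).

Let flt x y : f x < f y -> x < y.
Proof. by rewrite !ltNge; apply: contra => /fmono. Qed.

Let fpre b : exists a, f a = b.
Proof. by have : setT b by []; rewrite -fsurj => -[a _]; exists a. Qed.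

(** Cofinality and coinitiality of X in the fibres are what is needed when the
    point of Y that might separate f x from f i is f x itself: x then lies in
    the fibre over it, and a point of X beyond x in this fibre separates x
    from i. *)
Lemma preimage_component i : ~ Y (f i) ->
  f @^-1` component Y (f i) = component X i.
Proof.
move=> nYi.
(* Points of X are compared with z as their images are with f z. *)
have sep d (Xd : X d) z : ~ Y (f z) ->
    (f d < f z) = (d < z) /\ (f z < f d) = (z < d).
  move=> nYz; have fdz : f d != f z.
    by apply/eqP => e; apply: nYz; rewrite -e; apply: fXY; exists d.
  split; apply/idP/idP; try exact: flt.
  - by move=> /ltW/fmono; rewrite le_eqVlt (negPf fdz).
  - by move=> /ltW/fmono; rewrite le_eqVlt eq_sym (negPf fdz).
apply/seteqP; split => x /= cx.
  move=> d Xd.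
  have nYx : ~ Y (f x).
    move=> Yx; have := component_disjoint nYi.
    by move=> /seteqP[/(_ (f x)) + _]; apply; split.
  have [<- <-] := sep d Xd x nYx; have [<- <-] := sep d Xd i nYi.
  by apply: cx; apply: fXY; exists d.
move=> e Ye; have [a ae] := fpre e; rewrite -{}ae in Ye *.
have below z : f z <= f a -> exists d, [/\ X d, f d = f a & z <= d].
  rewrite le_eqVlt => /orP[/eqP za|/flt za].
    by rewrite -za; apply: (wit _).1; rewrite za.
  have [[d [Xd fd ad]] _] := wit Ye.
  by exists d; split=> //; apply: le_trans (ltW za) ad.
have above z : f a <= f z -> exists d, [/\ X d, f d = f a & d <= z].
  rewrite le_eqVlt => /orP[/eqP za|/flt za].
    by rewrite za; apply: (wit _).2; rewrite -za.
  have [_ [d [Xd fd ad]]] := wit Ye.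
  by exists d; split=> //; apply: le_trans ad (ltW za).
have nai : f a != f i by apply/eqP => e'; apply: nYi; rewrite -e'.
case: (ltgtP (f a) (f i)) nai => // ai _.
  suff lt : f a < f x.
    by rewrite lt; split=> //; apply/negbTE; rewrite -leNgt ltW.
  rewrite ltNge; apply/negP => /below[d [Xd fd xd]].
  rewrite -fd in ai; have := (cx d Xd).1; rewrite (flt ai).
  by rewrite ltNge xd.
suff lt : f x < f a.
  by rewrite lt; split=> //; apply/negbTE; rewrite -leNgt ltW.
rewrite ltNge; apply/negP => /above[d [Xd fd xd]].
rewrite -fd in ai; have := (cx d Xd).2; rewrite (flt ai).
by rewrite ltNge xd.
Qed.

Lemma complementary_lift J : complementary_interval Y J ->
  exists I, complementary_interval X I /\ f @^-1` J = I.
Proof.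
move=> cJ; have [[[j Jj] _] Jdis _] := cJ.
have [i ij] := fpre j; rewrite -{}ij in Jj.
have nYi : ~ Y (f i) by move=> Yi; have : set0 (f i) by rewrite -Jdis.
exists (component X i); split.
  by apply: component_complementary => Xi; apply: nYi; apply: fXY; exists i.
by rewrite (complementary_is_component cJ Jj) preimage_component.
Qed.

Lemma left_endpoint_transfer :
  (forall I, complementary_interval X I -> has_left_endpoint I) ->
  forall J, complementary_interval Y J -> has_left_endpoint J.
Proof.
move=> hX J /complementary_lift[I [/hX[a Ia bnd] JI]]; rewrite -{I}JI in Ia bnd.
exists (f a) => // b Jb; have [y yb] := fpre b; rewrite -yb in Jb *.
exact/fmono/bnd.
Qed.

Lemma right_endpoint_transfer :
  (forall I, complementary_interval X I -> has_right_endpoint I) ->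
  forall J, complementary_interval Y J -> has_right_endpoint J.
Proof.
move=> hX J /complementary_lift[I [/hX[a Ia bnd] JI]]; rewrite -{I}JI in Ia bnd.
exists (f a) => // b Jb; have [y yb] := fpre b; rewrite -yb in Jb *.
exact/fmono/bnd.
Qed.

End Transfer.

(** * Good indices form a club *)

Section FibresWitnessedClub.
Context {dW : Order.disp_t} {W : orderType dW} (hW : is_omega1 W).
Context {dA dB : Order.disp_t} {A : orderType dA} {B : orderType dB}.
Hypothesis noomega1 : ~ (exists g : W -> A, {mono g : x y / x <= y}).
Hypothesis noomega1V : ~ (exists g : W -> A, {mono g : x y /~ x <= y}).
Variables (D : W -> set A) (E : W -> set B).
Hypotheses (hD : decomposition D) (hE : decomposition E).
Variables (f : A -> B).

Let witness_step eta zeta :=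
  f @` D eta `<=` E zeta /\ fibres_witnessed f (D zeta) (E eta).

Lemma witness_step_exists eta :
  exists2 zeta, witness_step eta zeta & eta < zeta.
Proof.
have [cD Dmono _ _] := hD; have [cE Emono _ _] := hE.
have [z1 fz1] : exists z1, f @` D eta `<=` E z1.
  apply: (decomposition_absorbs hW hE).
  exact: sub_countable (card_image_le _ _) (cD eta).
have /boolp.choice[U UP] b : exists Y, [/\ countable Y,
    Y `<=` f @^-1` [set b] &
    forall x, f x = b -> exists2 y, Y y & x <= y].
  exact: (countable_cofinal hW).
have /boolp.choice[L LP] b : exists Y, [/\ countable Y,
    Y `<=` f @^-1` [set b] &
    forall x, f x = b -> exists2 y, Y y & y <= x].
  exact: (countable_coinitial hW).
have [z2 Uz2] : exists z2, \bigcup_(b in E eta) U b `<=` D z2.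
  apply: (decomposition_absorbs hW hD).
  by apply: bigcup_countable => // b _; case: (UP b).
have [z3 Lz3] : exists z3, \bigcup_(b in E eta) L b `<=` D z3.
  apply: (decomposition_absorbs hW hD).
  by apply: bigcup_countable => // b _; case: (LP b).
have [zeta ub] := omega1_ub hW
  (finite_set_countable (finite_seq [:: z1; z2; z3; eta])).
have ubin z : z \in [:: z1; z2; z3; eta] -> z < zeta by apply: ub.
exists zeta; last by apply: ubin; rewrite !inE eqxx !orbT.
split.
  apply: subset_trans fz1 _; apply/Emono/ltW/ubin.
  by rewrite !inE eqxx.
move=> a Ea; split.
  have [_ Uf /(_ a erefl)[y Uy ay]] := UP (f a).
  exists y; split=> //; last exact: Uf.
  apply: Dmono (Uz2 y _); last by exists (f a).
  by apply/ltW/ubin; rewrite !inE eqxx !orbT.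
have [_ Lf /(_ a erefl)[y Ly ay]] := LP (f a).
exists y; split=> //; last exact: Lf.
apply: Dmono (Lz3 y _); last by exists (f a).
by apply/ltW/ubin; rewrite !inE eqxx !orbT.
Qed.

(** At a limit closed under witness_step, the decompositions are unions of
    their earlier stages, so each point of D_xi or E_xi is treated by a step
    that is completed before xi. *)
Lemma club_fibres_witnessed : exists2 C : set W, club C &
  forall xi, C xi -> f @` D xi `<=` E xi /\ fibres_witnessed f (D xi) (E xi).
Proof.
have [_ Dmono _ Dlim] := hD; have [_ Emono _ Elim] := hE.
eexists.
  apply: (@club_closure_points _ _ hW witness_step);
    last exact: witness_step_exists.
  move=> eta eta' zeta le [fDE wit]; split.
    by apply: subset_trans fDE; apply: image_subset; apply: Dmono.
  by move=> a Ea; apply: wit; apply: Emono Ea.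
move=> xi [lim cl]; split.
  move=> _ [a Da <-]; move: Da; rewrite Dlim // => -[eta lt Da].
  have [zeta [fDE _] zx] := cl _ lt.
  by apply: (Emono zeta) (ltW zx) _ _; apply: fDE; exists a.
move=> a; rewrite Elim // => -[eta lt Ea].
have [zeta [_ wit] zx] := cl _ lt.
have [[d [Dd fd ad]] [d' [Dd' fd' ad']]] := wit _ Ea.
by split; [exists d|exists d']; split=> //; apply: (Dmono zeta) (ltW zx) _ _.
Qed.

End FibresWitnessedClub.

(** * Left and right endpoints along an epimorphism of Aronszajn lines *)

Theorem theorem1p9
  (dW : Order.disp_t) (W : orderType dW) (hW : is_omega1 W)
  (R : realType)
  (dA : Order.disp_t) (A : orderType dA) (hA : aronszajn_line W R A)
  (dB : Order.disp_t) (B : orderType dB) (hB : aronszajn_line W R B)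
  (D : W -> set A) (hD : decomposition D)
  (E : W -> set B) (hE : decomposition E)
  (hBA : epi_le B A) :
  ~ stationary (Lhat D `\` Lhat E) /\ ~ stationary (Rhat D `\` Rhat E).
Proof.
have [B0|[f [fmono fsurj]]] := hBA.
  by case: hB; rewrite B0 => /(_ (countable0 _)).
have [_ noW noWV _] := hA.
have [C clubC CP] := club_fibres_witnessed hW noW noWV hD hE f.
split=> /(_ C clubC)[xi [[Dxi nExi] /CP[fDE wit]]]; apply: nExi => J cJ.
  exact (left_endpoint_transfer fmono fsurj fDE wit Dxi cJ).
exact (right_endpoint_transfer fmono fsurj fDE wit Dxi cJ).
Qed.
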